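(* Let $n\ge 1$. The set of type 1 signed arc permutations, $$\bigcup_{2\le k\le n}\{\,k\;\,k+1\;\dots\;n\;\,1\;\,2\;\dots\;k-1\,\}\ \cup\ \{\,1\;2\;\dots\;n\,\}\subset B_n,$$ is in descent preserving bijection with the set of all standard domino tableaux of shapes $(2n)$ and $(2n-2,1,1)$.
   Context: $B_n$ is the hyperoctahedral group of all permutations $\pi$ of $\{-n,\dots,-1,0,1,\dots,n\}$ with $\pi(-i)=-\pi(i)$ for all $i$; $\pi$ is identified with the word $\pi(1)\cdots\pi(n)$. For $\pi\in B_n$, $Des(\pi)=\{0\le i\le n-1 \mid \pi(i)>\pi(i+1)\}$ (with $\pi(0)=0$). Young diagrams are drawn with left-justified rows, row 1 on top. A standard domino tableau of shape $\lambda$, $\lambda$ a partition of $2n$, is a tiling of the Young diagram of $\lambda$ by $n$ dominoes ($1\times 2$ or $2\times 1$ rectangles) labelled bijectively by $\{1,\dots,n\}$, labels strictly increasing along rows and down columns (comparing distinct dominoes). A standard domino tableau $T$ has a descent in position $i$, $1\le i\le n-1$, if the domino labelled $i+1$ lies strictly below the domino labelled $i$ (all boxes of domino $i+1$ lie in rows strictly lower than all boxes of domino $i$), and has a descent in position $0$ if the domino labelled $1$ is vertical; $Des(T)$ is the set of its descents. If an indicated shape is not a partition (which happens for $(2n-2,1,1)$ only when $n=1$), there are no tableaux of that shape. A bijection $f$ from a set of signed permutations to a set of standard domino tableaux is descent preserving if $Des(f(\pi))=Des(\pi)$ for all $\pi$. *)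

(* Defs.v *)
From HB Require Import structures.
From mathcomp Require Import all_boot all_order all_algebra all_fingroup.

Set Implicit Arguments.
Unset Strict Implicit.
Unset Printing Implicit Defensive.

(* The interval {-n, ..., n} of int is encoded as 'I_(2n+1), an ordinal a
   standing for the integer a - n; the encoding is increasing, and rev_ord
   (a |-> 2n - a) is negation. *)
Definition signed_interval (n : nat) := 'I_(n.*2.+1).

Definition int_of_si (n : nat) (a : signed_interval n) : int := (a%:Z - n%:Z)%R.

Definition si_of_nat (n i : nat) : signed_interval n := inord (n + i).

(* The hyperoctahedral group B_n. *)
Record signed_perm (n : nat) := SignedPerm {
  sp_perm :> {perm signed_interval n};
  _ : [forall a : signed_interval n,
         sp_perm (rev_ord a) == rev_ord (sp_perm a)]
}.

HB.instance Definition _ (n : nat) := [isSub for @sp_perm n].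
HB.instance Definition _ (n : nat) := [Finite of signed_perm n by <:].

(* The integer pi(i), for 0 <= i <= n. *)
Definition sp_val (n : nat) (pi : signed_perm n) (i : nat) : int :=
  int_of_si (pi (si_of_nat n i)).

Definition sp_word (n : nat) (pi : signed_perm n) : seq int :=
  [seq sp_val pi i | i <- iota 1 n].

Definition sp_Des (n : nat) (pi : signed_perm n) : {set 'I_n} :=
  [set i : 'I_n | (sp_val pi i.+1 < sp_val pi i)%R].

(* The word k k+1 ... n 1 2 ... k-1. *)
Definition arc_word (n k : nat) : seq int :=
  [seq j%:Z%R | j <- iota k (n.+1 - k) ++ iota 1 k.-1].

Definition type1_arc (n : nat) : {set signed_perm n} :=
  [set pi : signed_perm n |
     [exists k : 'I_n.+1, (2 <= k) && (sp_word pi == arc_word n k)]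
     || (sp_word pi == [seq j%:Z%R | j <- iota 1 n])].

Definition is_partition_of (m : nat) (sh : seq nat) : bool :=
  [&& sorted geq sh, 0 \notin sh & sumn sh == m].

(* A box is a pair (row, column); both are counted from 0, row 0 on top. *)
Definition box := (nat * nat)%type.

Definition diagram (sh : seq nat) : seq box :=
  [seq (r, c) | r <- iota 0 (size sh), c <- iota 0 (nth 0 sh r)].

(* A domino is given by its top left box and by whether it is vertical. *)
Definition domino := (box * bool)%type.

Definition vertical (d : domino) : bool := d.2.

Definition boxes (d : domino) : seq box :=
  let: (r, c) := d.1 in
  [:: (r, c); if vertical d then (r.+1, c) else (r, c.+1)].

(* b lies to the left of b' in the same row, or above b' in the same column. *)
Definition box_precedes (b b' : box) : bool :=
  ((b.1 == b'.1) && (b.2 < b'.2)) || ((b.2 == b'.2) && (b.1 < b'.1)).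

(* A labelled family of n dominoes is the tuple of its dominoes in increasing
   order of labels: the entry of index i carries the label i + 1. *)
Definition labels_increase (n : nat) (T : n.-tuple domino) : bool :=
  [forall i : 'I_n, forall j : 'I_n, (i != j) ==>
     all (fun b => all (fun b' => box_precedes b b' ==> (i < j))
                       (boxes (tnth T j)))
         (boxes (tnth T i))].

Definition standard_domino_tableau (n : nat) (sh : seq nat)
    (T : n.-tuple domino) : bool :=
  [&& is_partition_of n.*2 sh,
      perm_eq (flatten [seq boxes d | d <- T]) (diagram sh)
    & labels_increase T].

(* The domino labelled l, for 1 <= l <= n. *)
Definition domino_labelled (n : nat) (T : n.-tuple domino) (l : nat) : domino :=
  nth ((0, 0), false) T l.-1.

Definition strictly_below (d' d : domino) : bool :=
  all (fun b' => all (fun b => b.1 < b'.1) (boxes d)) (boxes d').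

Definition tableau_Des (n : nat) (T : n.-tuple domino) : {set 'I_n} :=
  [set i : 'I_n |
     if i == 0 :> nat then vertical (domino_labelled T 1)
     else strictly_below (domino_labelled T i.+1) (domino_labelled T i)].

(* Main.v *)
(** The descent set is the whole parameter on both sides.  The arc permutation
    whose word is the identity rotated by [m] has descent set [{m}] (empty if
    [m = 0]).  In shape [(2n-2,1,1)] the two lower boxes of the first column
    form a vertical domino, and the others tile the first row horizontally from
    left to right, so a tableau is determined by the label [m+1], [0 < m], of
    the vertical domino and has descent set [{m}]; shape [(2n)] carries only the
    horizontal tableau, which is the case [m = 0]. *)
Require Import Defs.
From HB Require Import structures.
From mathcomp Require Import all_boot all_order all_algebra all_fingroup.
From mathcomp Require Import zify.

Set Implicit Arguments.
Unset Strict Implicit.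
Unset Printing Implicit Defensive.

(** * Auxiliary facts on bijections, disjoint lists and spacing *)

(** Surjectivity is phrased with the boolean [==], so that [xchoose] on the finite domain yields an
    inverse. *)
Lemma inj_surj_bij (I : finType) (T : eqType) (F : I -> T) :
  injective F -> (forall y, exists i, F i == y) -> bijective F.
Proof.
move=> Finj Fsurj; exists (fun y => xchoose (Fsurj y)) => [i|y].
  exact/Finj/eqP/(xchooseP (Fsurj (F i))).
exact/eqP/(xchooseP (Fsurj y)).
Qed.

Lemma uniq_flatten_nth (T : eqType) (ss : seq (seq T)) (i j : nat) (x : T) :
  uniq (flatten ss) -> x \in nth [::] ss i -> x \in nth [::] ss j -> i = j.
Proof.
have mem_tail (rs : seq (seq T)) k : x \in nth [::] rs k -> x \in flatten rs.
  have [lt_k|le_k] := ltnP k (size rs); last by rewrite nth_default.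
  by move=> xk; apply/flattenP; exists (nth [::] rs k); rewrite ?mem_nth.
elim: ss i j => [|s ss IH] [|i] [|j] //=; rewrite cat_uniq => /and3P[_ /hasPn no uss].
- by move=> xs /mem_tail /no; rewrite /= xs.
- by move=> /mem_tail /no /= /negP.
- by move=> xi xj; congr _.+1; apply: IH xi xj.
Qed.

(** The gaps force [c i] to be at least [2i] counting from the left; counting back from the last
    term, which is at most [2N - 2], they force [c i] to be at most [2i]. *)
Lemma tight_spacing (N : nat) (c : nat -> nat) :
  (forall i, i.+1 < N -> c i + 2 <= c i.+1) ->
  (forall i, i < N -> (c i).+1 < N.*2) ->
  forall i, i < N -> c i = i.*2.
Proof.
move=> step bnd i lt_iN.
have lower : i.*2 <= c i.
  elim: i lt_iN => [//|i IH] lt_iN.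
  by have := IH (ltnW lt_iN); have := step i lt_iN; lia.
have upper k : i + k < N -> c i + k.*2 <= c (i + k).
  elim: k => [|k IH] lt_k; first by rewrite !addn0.
  have := step (i + k); rewrite -addnS => /(_ lt_k).
  by have := IH ltac:(lia); lia.
have := upper (N.-1 - i) ltac:(lia); have := bnd (i + (N.-1 - i)) ltac:(lia); lia.
Qed.

(** * Arc permutations as rotations of the identity *)

(** Moves the [m] largest letters to the front: the word is [n-m+1 ... n 1 ... n-m], with 0
    fixed. *)
Definition rotate (n m j : nat) : nat :=
  if j == 0 then 0 else if j <= m then j + (n - m) else j - m.

(** The odd extension of [rotate], in the encoding where [n] stands for 0. *)
Definition signed_rotate (n m a : nat) : nat :=
  if a < n then n - rotate n m (n - a) else n + rotate n m (a - n).

Lemma signed_rotate_lt (n : nat) (m : 'I_n) (a : signed_interval n) :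
  signed_rotate n m a < n.*2.+1.
Proof.
case: m a => m lt_m [a lt_a] /=; rewrite /signed_rotate /rotate.
by do ?case: ifP => ?; lia.
Qed.

Definition arc_fun (n : nat) (m : 'I_n) (a : signed_interval n) :
    signed_interval n :=
  Ordinal (signed_rotate_lt m a).

Lemma arc_fun_inj (n : nat) (m : 'I_n) : injective (@arc_fun n m).
Proof.
case: m => m lt_m [a lt_a] [b lt_b] /(congr1 val) /=.
rewrite /signed_rotate /rotate => eq_ab; apply: val_inj => /=; move: eq_ab.
by do ?case: ifP => ?; lia.
Qed.

Lemma arc_fun_odd (n : nat) (m : 'I_n) :
  [forall a : signed_interval n,
     perm (@arc_fun_inj n m) (rev_ord a) == rev_ord (perm (@arc_fun_inj n m) a)].
Proof.
apply/forallP=> a; rewrite !permE; apply/eqP/val_inj => /=.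
case: m a => m lt_m [a lt_a] /=; rewrite /signed_rotate /rotate.
by do ?case: ifP => ?; lia.
Qed.

Definition arc_perm (n : nat) (m : 'I_n) : signed_perm n :=
  SignedPerm (arc_fun_odd m).

Lemma sp_val_arc_perm (n : nat) (m : 'I_n) (i : nat) :
  i <= n -> sp_val (arc_perm m) i = (rotate n m i)%:Z%R.
Proof.
move=> le_in; rewrite /sp_val /int_of_si permE /= inordK; last by lia.
by rewrite /signed_rotate addKn; case: ifP; lia.
Qed.

(** The first letter is [k = n + 1 - m]. For [m = 0] the first block of [arc_word] is empty and the
    second is the identity word. *)
Lemma sp_word_arc_perm (n : nat) (m : 'I_n) :
  sp_word (arc_perm m) = arc_word n (n.+1 - m).
Proof.
have lt_m := ltn_ord m.
apply: (@eq_from_nth _ 0%R) => [|i].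
  by rewrite !size_map size_cat !size_iota; lia.
rewrite size_map size_iota => lt_in.
rewrite (nth_map 0) ?size_iota // nth_iota // sp_val_arc_perm; last by lia.
rewrite (nth_map 0) ?size_cat ?size_iota; last by lia.
rewrite nth_cat size_iota /rotate.
by case: ltnP => ?; rewrite nth_iota; do ?case: ifP => ?; lia.
Qed.

(** Oddness carries the positive values over to the negative positions, and 0, the only fixed point
    of negation, must be sent to itself. *)
Lemma sp_word_inj (n : nat) : injective (@sp_word n).
Proof.
move=> p q eq_w.
have podd (w : signed_perm n) a : w (rev_ord a) = rev_ord (w a).
  by case: w => w /= /forallP/(_ a)/eqP.
have eq_pos i : 0 < i <= n -> p (si_of_nat n i) = q (si_of_nat n i).
  move=> i_bnd; have : nth 0%R (sp_word p) i.-1 = nth 0%R (sp_word q) i.-1.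
    by rewrite eq_w.
  rewrite !(nth_map 0) ?size_iota; try lia.
  rewrite nth_iota; last by lia.
  rewrite /sp_val /int_of_si add1n prednK; last by lia.
  by move=> eq_i; apply: val_inj => /=; lia.
have pos (a : signed_interval n) : n < a -> p a = q a.
  move=> lt_na; suff -> : a = si_of_nat n (a - n).
    by apply: eq_pos; have := ltn_ord a; lia.
  by apply: val_inj; rewrite /= inordK; have := ltn_ord a; lia.
apply/val_inj/permP => a /=.
have lt_a := ltn_ord a.
have [/pos //|lt_an|eq_an] := ltngtP n a.
  apply: rev_ord_inj; rewrite -!podd; apply: pos.
  by rewrite /=; lia.
have a_fix : rev_ord a = a by apply: val_inj => /=; lia.
have mid (w : signed_perm n) : w a = n :> nat.
  by have := congr1 val (podd w a); rewrite a_fix /=; have := ltn_ord (w a); lia.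
by apply: val_inj; rewrite /= !mid.
Qed.

Lemma arc_perm_type1 (n : nat) (m : 'I_n) : arc_perm m \in type1_arc n.
Proof.
have lt_m := ltn_ord m; rewrite inE sp_word_arc_perm.
have [m0|m_gt0] := posnP m.
  by apply/orP; right; rewrite m0 subn0 /arc_word subnn.
apply/orP; left; apply/existsP.
have lt_k : n.+1 - m < n.+1 by lia.
by exists (Ordinal lt_k); rewrite /= eqxx andbT; lia.
Qed.

Lemma type1_arc_perm (n : nat) (pi : signed_perm n) :
  0 < n -> pi \in type1_arc n -> exists m : 'I_n, arc_perm m = pi.
Proof.
move=> n_gt0; rewrite inE => /orP[/existsP[k /andP[k_ge2 /eqP word_pi]]|/eqP word_pi].
  (* Here [k >= 2] is what makes the parameter [n + 1 - k] smaller than [n]. *)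
  have lt_k := ltn_ord k; have lt_m : n.+1 - k < n by lia.
  exists (Ordinal lt_m); apply: sp_word_inj; rewrite sp_word_arc_perm word_pi.
  by rewrite /= subKn // ltnW.
exists (Ordinal n_gt0); apply: sp_word_inj; rewrite sp_word_arc_perm word_pi.
by rewrite /= subn0 /arc_word subnn.
Qed.

Definition descent_at (n : nat) (m : 'I_n) : {set 'I_n} :=
  [set i : 'I_n | (0 < m) && (i == m)].

(** Yields the injectivity of both parametrizations, since the descent set recovers the
    parameter. *)
Lemma descent_at_inj (n : nat) : injective (@descent_at n).
Proof.
move=> m p eq_mp.
have mem_mp i : (0 < m) && (i == m) = (0 < p) && (i == p).
  by have /setP/(_ i) := eq_mp; rewrite !inE.
have := mem_mp m; have := mem_mp p; rewrite !eqxx !andbT.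
have [m0|m_gt0] := posnP m; have [p0|p_gt0] := posnP p => //=.
  by move=> *; apply: val_inj; rewrite /= m0 p0.
by move=> /eqP.
Qed.

Lemma sp_Des_arc_perm (n : nat) (m : 'I_n) : sp_Des (arc_perm m) = descent_at m.
Proof.
apply/setP => i; rewrite !inE; have lt_i := ltn_ord i; have lt_m := ltn_ord m.
rewrite !sp_val_arc_perm; try lia.
by rewrite -val_eqE /= /rotate; do ?case: ifP => ?; lia.
Qed.

(** * The tableau with a given parameter *)

(** The index [j] stands for the label [j + 1]. Dominoes after the vertical one move back one place,
    so that the first row has no gap. *)
Definition hook_domino (m j : nat) : domino :=
  if (0 < m) && (j == m) then ((1, 0), true)
  else ((0, (j - ((0 < m) && (m < j))).*2), false).

Definition hook_tableau (n : nat) (m : 'I_n) : n.-tuple domino :=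
  [tuple hook_domino m i | i < n].

Definition hook_shape (n m : nat) : seq nat :=
  if m == 0 then [:: n.*2] else [:: n.*2 - 2; 1; 1].

Lemma mem_diagram (sh : seq nat) (r c : nat) :
  ((r, c) \in diagram sh) = (c < nth 0 sh r).
Proof.
apply/allpairsPdep/idP => [[r' [c' [_]]]|lt_c].
  by rewrite mem_iota => /andP[_ lt_c] [-> ->].
exists r, c; rewrite !mem_iota !add0n; split=> //.
by case: (ltnP r (size sh)) lt_c => // le_r; rewrite nth_default.
Qed.

Lemma diagram_uniq (sh : seq nat) : uniq (diagram sh).
Proof.
apply: allpairs_uniq_dep => [|r _|[r c] [r' c'] _ _ /= [-> ->]] //; exact: iota_uniq.
Qed.

Lemma size_diagram (sh : seq nat) : size (diagram sh) = sumn sh.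
Proof.
rewrite size_allpairs_dep; congr sumn.
rewrite -[in RHS](mkseq_nth 0 sh) /mkseq.
by apply: eq_map => r; rewrite size_iota.
Qed.

Lemma size_flatten_boxes (s : seq domino) :
  size (flatten [seq boxes d | d <- s]) = (size s).*2.
Proof. by elim: s => [//|[[r c] v] s IH] /=; rewrite IH doubleS. Qed.

Lemma sumn_hook_shape (n m : nat) : m < n -> sumn (hook_shape n m) = n.*2.
Proof. by rewrite /hook_shape; case: eqP => /= *; lia. Qed.

Lemma hook_shape_partition (n m : nat) :
  m < n -> is_partition_of n.*2 (hook_shape n m).
Proof.
move=> lt_m; rewrite /is_partition_of sumn_hook_shape // eqxx andbT.
by rewrite /hook_shape; case: eqP => m0 /=; rewrite !inE /=; lia.
Qed.

Lemma hook_domino_cover (n m : nat) (b : box) :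
  m < n -> b \in diagram (hook_shape n m) ->
  exists2 j, j < n & b \in boxes (hook_domino m j).
Proof.
case: b => r c lt_m; rewrite mem_diagram /hook_shape.
have [m0|m_gt0] := posnP m.
  rewrite m0; case: r => [|r] /=; last by rewrite nth_nil.
  move=> lt_c; exists c./2; first by lia.
  by rewrite !inE !xpair_eqE /=; lia.
case: r => [|[|[|r]]] /= lt_c.
(* The box lies in the horizontal domino number [c./2], whose index skips [m]. *)
- pose j := c./2; exists (j + (m <= j)); first by rewrite /j; lia.
  rewrite /hook_domino ifF; last by lia.
  by rewrite m_gt0 !inE !xpair_eqE /= /j; lia.
- by exists m; rewrite // /hook_domino m_gt0 eqxx !inE !xpair_eqE /=; lia.
- by exists m; rewrite // /hook_domino m_gt0 eqxx !inE !xpair_eqE /=; lia.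
- by move: lt_c; rewrite nth_nil.
Qed.

Lemma hook_tableau_labels (n : nat) (m : 'I_n) :
  labels_increase (hook_tableau m).
Proof.
apply/forallP => i; apply/forallP => j; apply/implyP => /eqP neq_ij.
have {}neq_ij : i <> j :> nat by move=> /val_inj.
rewrite !tnth_mktuple /hook_domino.
by do ?case: ifP => ?; rewrite /boxes /box_precedes /= ?andbT; lia.
Qed.

(** By counting: [n] dominoes have [2n] boxes in all, as many as the diagram, so once they cover it
    they neither overlap nor leave it. *)
Lemma hook_tableau_standard (n : nat) (m : 'I_n) :
  standard_domino_tableau (hook_shape n m) (hook_tableau m).
Proof.
apply/and3P; split; [exact: hook_shape_partition | | exact: hook_tableau_labels].
have size_eq : size (flatten [seq boxes d | d <- hook_tableau m])
    = size (diagram (hook_shape n m)).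
  by rewrite size_flatten_boxes size_tuple size_diagram sumn_hook_shape.
have sub : {subset diagram (hook_shape n m)
             <= flatten [seq boxes d | d <- hook_tableau m]}.
  move=> b /(hook_domino_cover (ltn_ord m))[j lt_j b_j].
  apply/flatten_mapP; exists (hook_domino m j) => //.
  by apply/tnthP; exists (Ordinal lt_j); rewrite tnth_mktuple.
have [_ eq_mem] := uniq_min_size (diagram_uniq _) sub (eq_leq size_eq).
rewrite perm_sym uniq_perm ?diagram_uniq //.
by apply: leq_size_uniq (diagram_uniq _) sub (eq_leq size_eq).
Qed.

Lemma tableau_Des_hook (n : nat) (m : 'I_n) :
  tableau_Des (hook_tableau m) = descent_at m.
Proof.
apply/setP => i; rewrite !inE -val_eqE /domino_labelled.
have nthE j : j < n -> nth ((0, 0), false) (hook_tableau m) j = hook_domino m j.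
  by move=> lt_j; rewrite -[j]/(val (Ordinal lt_j)) -tnth_nth tnth_mktuple.
have lt_i := ltn_ord i; have lt_m := ltn_ord m.
rewrite !nthE /=; try lia.
rewrite /hook_domino; do ?case: ifP => ? //=;
  rewrite /strictly_below /boxes /= ?andbT; lia.
Qed.

(** * Constraints on an arbitrary standard domino tableau *)

Section StandardTableau.

Variables (n : nat) (sh : seq nat) (T : n.-tuple domino).
Hypothesis stdT : standard_domino_tableau sh T.

Lemma tableau_box_diagram (i : 'I_n) (b : box) :
  b \in boxes (tnth T i) -> b \in diagram sh.
Proof.
move=> b_i; have /and3P[_ /perm_mem <- _] := stdT.
by apply/flatten_mapP; exists (tnth T i); rewrite ?mem_tnth.
Qed.

Lemma diagram_box_tableau (b : box) :
  b \in diagram sh -> exists i : 'I_n, b \in boxes (tnth T i).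
Proof.
have /and3P[_ /perm_mem <- _] := stdT.
by move=> /flatten_mapP[d /tnthP[i ->]] b_i; exists i.
Qed.

Lemma tableau_box_inj (i j : 'I_n) (b : box) :
  b \in boxes (tnth T i) -> b \in boxes (tnth T j) -> i = j.
Proof.
have /and3P[_ /perm_uniq eq_uniq _] := stdT.
have nthE (k : 'I_n) : nth [::] [seq boxes d | d <- T] k = boxes (tnth T k).
  by rewrite (nth_map ((0, 0), false)) ?size_tuple // -tnth_nth.
rewrite -!nthE => b_i b_j; apply: val_inj; apply: uniq_flatten_nth b_i b_j.
by rewrite eq_uniq diagram_uniq.
Qed.

Lemma tableau_box_lt (i j : 'I_n) (b b' : box) :
  b \in boxes (tnth T i) -> b' \in boxes (tnth T j) -> i != j ->
  box_precedes b b' -> i < j.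
Proof.
have /and3P[_ _ /forallP/(_ i)/forallP/(_ j)/implyP lab] := stdT.
by move=> b_i b'_j /lab/allP/(_ _ b_i)/allP/(_ _ b'_j)/implyP.
Qed.

(** Disjointness rules out columns at distance at most 1, and the increase of labels along the row
    rules out [c' < c]. *)
Lemma row0_horizontal_lt (i j : 'I_n) (c c' : nat) :
  tnth T i = ((0, c), false) -> tnth T j = ((0, c'), false) -> i < j ->
  c + 2 <= c'.
Proof.
move=> Ti Tj lt_ij.
have disj d : (0, d) \in boxes (tnth T i) -> (0, d) \notin boxes (tnth T j).
  by move=> d_i; apply/negP => /(tableau_box_inj d_i) eq_ij; rewrite eq_ij ltnn in lt_ij.
have := disj c; have := disj c.+1; rewrite Ti Tj !inE !xpair_eqE !eqxx ?orbT /=.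
have [//|lt_c'c|->] := ltngtP c c'; try lia.
have := @tableau_box_lt j i (0, c') (0, c).
rewrite Ti Tj !inE !eqxx /box_precedes /= lt_c'c => /(_ isT isT).
by rewrite -val_eqE /=; lia.
Qed.

(** Here [idx] lists [N] horizontal dominoes by increasing label. In a row of length [2N] they have
    no slack, so [tight_spacing] fixes their columns. *)
Lemma row0_tiling (N : nat) (idx : nat -> 'I_n) :
  nth 0 sh 0 = N.*2 ->
  (forall k, k.+1 < N -> idx k < idx k.+1) ->
  (forall k, k < N -> exists c, tnth T (idx k) = ((0, c), false)) ->
  forall k, k < N -> tnth T (idx k) = ((0, k.*2), false).
Proof.
move=> row0 idx_incr horiz.
pose c k := (tnth T (idx k)).1.2.
have horizE k : k < N -> tnth T (idx k) = ((0, c k), false).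
  by move=> /horiz[d]; rewrite /c => ->.
move=> k lt_kN; rewrite horizE //; congr (_, _, _).
apply: tight_spacing lt_kN => i lt_i.
  by apply: (row0_horizontal_lt (horizE i _) (horizE i.+1 _) (idx_incr i _)); lia.
(* The upper bound says that the right box of the domino lies in the diagram. *)
rewrite -row0 -mem_diagram; apply: (@tableau_box_diagram (idx i)).
by rewrite horizE // !inE eqxx orbT.
Qed.

End StandardTableau.

(** * Classification of the tableaux of both shapes *)

Lemma row_tableau_eq (n : nat) (T : n.-tuple domino) (n_gt0 : 0 < n) :
  standard_domino_tableau [:: n.*2] T -> T = hook_tableau (Ordinal n_gt0).
Proof.
move=> stdT; apply: eq_from_tnth => i; rewrite tnth_mktuple /hook_domino /= subn0.
pose idx := insubd (Ordinal n_gt0).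
have idxE k : k < n -> idx k = k :> nat by move=> lt_k; rewrite val_insubd lt_k.
have -> : i = idx i by apply: val_inj; rewrite [RHS]idxE.
rewrite idxE //; apply: (row0_tiling stdT) => // k lt_k.
  by rewrite !idxE // ltnW.
(* A vertical domino would need a box in a second row. *)
case Tk : (tnth T (idx k)) => [[r c] v]; exists c.
have in_diag b := @tableau_box_diagram _ _ _ stdT (idx k) b.
move: (in_diag (r, c)) (in_diag (r.+1, c)).
rewrite Tk !inE !mem_diagram eqxx /= nth_nil => /(_ isT).
case: r {Tk} => [|r] /=; last by rewrite nth_nil.
by case: v => /= _ => [/(_ (eqxx _))|].
Qed.

(** The corner box [(2, 0)] forces a vertical domino on the two lower rows. All other dominoes then
    lie in row 0, where [row0_tiling] applies with [N = n - 1]. *)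
Lemma hook_tableau_eq (n : nat) (T : n.-tuple domino) :
  standard_domino_tableau [:: n.*2 - 2; 1; 1] T ->
  exists2 m : 'I_n, 0 < m & T = hook_tableau m.
Proof.
move=> stdT.
have in_diag i b := @tableau_box_diagram _ _ _ stdT i b.
(* For smaller [n] the first part is 0, which a partition excludes. *)
have n_gt1 : 1 < n.
  by have /and3P[/and3P[_ ]] := stdT; rewrite !inE; lia.
have [m Tm] : exists m, tnth T m = ((1, 0), true).
  have [|m b_m] := @diagram_box_tableau _ _ _ stdT (2, 0); first by rewrite mem_diagram.
  exists m; move: b_m (in_diag m).
  (* Any other position of the domino covering [(2, 0)] would use [(3, 0)] or [(2, 1)], outside the
     diagram, or a negative column. *)
  case: (tnth T m) => [[r c] []]; rewrite !inE !xpair_eqE /=.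
    move=> /orP[/andP[/eqP<- /eqP<-]|/andP[/eqP[<-] /eqP<-]] // /(_ (3, 0)).
    by rewrite !inE mem_diagram eqxx orbT => /(_ isT).
  move=> /orP[/andP[/eqP<- /eqP<-]|/andP[_ /eqP]] // /(_ (2, 1)).
  by rewrite !inE mem_diagram eqxx orbT => /(_ isT).
have box_m i b : b \in [:: (1, 0); (2, 0)] -> b \in boxes (tnth T i) -> i = m.
  by move=> b_m b_i; apply: (tableau_box_inj stdT b_i); rewrite Tm.
have horiz i : i != m -> exists c, tnth T i = ((0, c), false).
  move=> neq_im; case Ti : (tnth T i) => [[r c] v]; exists c.
  have row0 r' c' : (r', c') \in boxes (tnth T i) -> r' = 0.
    move=> b_i; have := in_diag i _ b_i; rewrite mem_diagram.
    case: r' b_i => [|[|[|r']]] b_i //=; last by rewrite nth_nil.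
      by case: c' b_i => // /box_m eq_im; rewrite eq_im ?eqxx // in neq_im.
    by case: c' b_i => // /box_m eq_im; rewrite eq_im ?eqxx // in neq_im.
  have r0 : r = 0 by apply: (row0 r c); rewrite Ti !inE eqxx.
  case: v Ti => // Ti; last by rewrite r0.
  by have := row0 r.+1 c; rewrite Ti !inE eqxx orbT => /(_ isT).
(* The domino containing [(0, 0)] is not the vertical one and lies above it, so it has a smaller
   label. *)
have m_gt0 : 0 < m.
  have [|i b_i] := @diagram_box_tableau _ _ _ stdT (0, 0).
    by rewrite mem_diagram /=; lia.
  apply: leq_ltn_trans (leq0n i) _.
  apply: (tableau_box_lt stdT b_i (b' := (1, 0))) => //; first by rewrite Tm.
  by apply/eqP => eq_im; move: b_i; rewrite eq_im Tm.
exists m => //; apply: eq_from_tnth => i; rewrite tnth_mktuple /hook_domino m_gt0.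
case: eqVneq => [/val_inj -> //|neq_im] /=.
(* [bump m] enumerates the indices other than [m] in increasing order; the default [m] is reached
   only from [k >= n - 1]. *)
pose idx k := insubd m (bump m k).
have lt_m := ltn_ord m; have lt_i := ltn_ord i.
have idxE k : k < n.-1 -> idx k = bump m k :> nat.
  by move=> lt_k; rewrite val_insubd ifT // /bump; lia.
have lt_k : i - (m < i) < n.-1 by lia.
have {1}-> : i = idx (i - (m < i)).
  by apply: val_inj; rewrite [RHS]idxE // /bump /=; lia.
apply: (row0_tiling stdT) lt_k => [|k lt_k|k lt_k].
- by rewrite /=; lia.
- by rewrite !idxE /bump; lia.
- by apply: horiz; rewrite -val_eqE /= idxE // eq_sym neq_bump.
Qed.

(** * The bijection through the common parameter *)

Theorem proposition7 (n : nat) (hn : 1 <= n) :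
  exists f : {w : signed_perm n | w \in type1_arc n} ->
             {T : n.-tuple domino |
                standard_domino_tableau [:: n.*2] T
                || standard_domino_tableau [:: n.*2 - 2; 1; 1] T},
    bijective f /\
    forall pi, tableau_Des (sval (f pi)) = sp_Des (sval pi).
Proof.
pose is_tab (T : n.-tuple domino) := standard_domino_tableau [:: n.*2] T
  || standard_domino_tableau [:: n.*2 - 2; 1; 1] T.
have tabP m : is_tab (hook_tableau m).
  have := hook_tableau_standard m; rewrite /is_tab /hook_shape.
  by case: eqP => _ ->; rewrite ?orbT.
pose arc m : {w : signed_perm n | w \in type1_arc n} :=
  exist _ (arc_perm m) (arc_perm_type1 m).
pose tab m : {T | is_tab T} := exist _ (hook_tableau m) (tabP m).
have tab_bij : bijective tab.
  apply: inj_surj_bij => [m p /(congr1 val) /= eq_mp|[T stdT]].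
    by apply: descent_at_inj; rewrite -!tableau_Des_hook eq_mp.
  case/orP: (stdT) => [/(row_tableau_eq hn)|/hook_tableau_eq[m _]] eq_T.
    by exists (Ordinal hn); rewrite -val_eqE /= eq_T.
  by exists m; rewrite -val_eqE /= eq_T.
have [arc' arcK arc'K] : bijective arc.
  apply: inj_surj_bij => [m p /(congr1 val) /= eq_mp|[w arc_w]].
    by apply: descent_at_inj; rewrite -!sp_Des_arc_perm eq_mp.
  have [m eq_w] := type1_arc_perm hn arc_w.
  by exists m; rewrite -val_eqE /= eq_w.
(* Read off the parameter of the permutation, then take the tableau with the same parameter; both
   have descent set [descent_at] of it. *)
exists (tab \o arc'); split; first by apply: bij_comp => //; exists arc.
by move=> w; rewrite -{2}[w]arc'K /= tableau_Des_hook sp_Des_arc_perm.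
Qed.
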